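(* Assume Martin's Axiom and the negation of the Continuum Hypothesis ($\mathrm{MA}+\neg\mathrm{CH}$). If $K$ is a compact Hausdorff and scattered space with finite height and $w(K)\ge\mathfrak c$, then there exists a nontrivial twisted sum of $c_0$ and $C(K)$.
   Context: $\mathfrak c$ is the cardinality of the continuum, and $w(K)$ is the weight of the topological space $K$ (the least cardinality of a base). For a topological space $\mathcal X$, $\mathcal X^{(\alpha)}$ denotes its $\alpha$-th Cantor--Bendixson derivative; $\mathcal X$ is scattered if $\mathcal X^{(\alpha)}=\emptyset$ for some ordinal $\alpha$. The least such $\alpha$ is the height of $\mathcal X$, and $\mathcal X$ has finite height if its height is a natural number. $C(K)$ is the Banach space of continuous real-valued functions on $K$ with the supremum norm, and $c_0$ is the Banach space of real sequences converging to $0$. Given Banach spaces $X$ and $Y$, a twisted sum of $Y$ and $X$ is an exact sequence $0\to Y\to Z\to X\to 0$ with $Z$ a Banach space and the arrows bounded linear operators; it is trivial if the image of $Y\to Z$ is complemented in $Z$, and nontrivial otherwise. *)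

(* Defs.v *)
From HB Require Import structures.
From mathcomp Require Import all_boot all_order all_algebra.
From mathcomp Require Import lra.
From mathcomp Require Import all_classical all_reals all_analysis.
Set Implicit Arguments.
Unset Strict Implicit.
Unset Printing Implicit Defensive.
Import Order.TTheory GRing.Theory Num.Theory.
Import numFieldNormedType.Exports.
Local Open Scope classical_set_scope.
Local Open Scope card_scope.
Local Open Scope ring_scope.

Definition card_lt T U (A : set T) (B : set U) : Prop :=
  (A #<= B) && (A #!= B).

(* All realTypes are isomorphic, so [set: R] has the cardinality of the
   continuum whatever R is. *)
Definition continuum_hypothesis (R : realType) : Prop :=
  forall A : set R, countable A \/ A #= [set: R].

Section Forcing.
Context {d : Order.disp_t} {P : porderType d}.
Local Open Scope order_scope.

Definition compatible (p q : P) : Prop := exists r : P, r <= p /\ r <= q.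

Definition antichain (A : set P) : Prop :=
  forall p q, A p -> A q -> p <> q -> ~ compatible p q.

Definition order_dense (D : set P) : Prop :=
  forall p : P, exists2 q, D q & q <= p.

Definition order_filter (G : set P) : Prop :=
  [/\ G !=set0,
      forall p q, G p -> p <= q -> G q &
      forall p q, G p -> G q -> exists r, [/\ G r, r <= p & r <= q]].

End Forcing.

Definition ccc d (P : porderType d) : Prop :=
  forall A : set P, antichain A -> countable A.

Definition martin_axiom (R : realType) : Prop :=
  forall (d : Order.disp_t) (P : porderType d),
    [set: P] !=set0 -> ccc P ->
    forall DD : set (set P),
      card_lt DD [set: R] -> (forall D, DD D -> order_dense D) ->
      exists2 G : set P, order_filter G & forall D, DD D -> G `&` D !=set0.

(* w(K) >= #|A|, the weight being the least cardinality of a base. *)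
Definition weight_ge (K : topologicalType) U (A : set U) : Prop :=
  forall B : set (set K), basis B -> A #<= B.

Definition cb_derivative (K : topologicalType) (n : nat) : set K :=
  iter n (fun A : set K => A `\` isolated A) setT.
Arguments cb_derivative : clear implicits.

Definition has_cb_height (K : topologicalType) (n : nat) : Prop :=
  cb_derivative K n = set0 /\
  forall m, cb_derivative K m = set0 -> (n <= m)%N.

(* Only natural stages are needed: a space whose height is a natural number is
   in particular scattered. *)
Definition scattered_finite_height (K : topologicalType) : Prop :=
  exists n, has_cb_height K n.

Record supNormSpace (R : realType) (T : Type) := SupNormSpace {
  sns_set :> set (T -> R) ;
  sns0 : sns_set 0 ;
  snsD : forall f g, sns_set f -> sns_set g -> sns_set (f + g) ;
  snsZ : forall (a : R) f, sns_set f -> sns_set (a *: f) ;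
  sns_bounded : forall f, sns_set f -> exists M, forall x, `|f x| <= M ;
  sns_closed : forall f,
    (forall e, 0 < e -> exists2 g, sns_set g & forall x, `|f x - g x| <= e) ->
    sns_set f }.

Section SupNorm.
Context (R : realType) (T : Type) (S : supNormSpace R T).

Definition sns_pred : {pred T -> R} := mem (sns_set S).

Record supFun := SupFun { supFun_val :> T -> R ; _ : supFun_val \in sns_pred }.

HB.instance Definition _ := [isSub for supFun_val].
HB.instance Definition _ := [Choice of supFun by <:].

Let sns_submod : submod_closed sns_pred.
Proof.
split=> [|a f g]; first by apply/mem_set; exact: sns0.
by move=> /set_mem Sf /set_mem Sg; apply/mem_set/snsD => //; exact: snsZ.
Qed.

HB.instance Definition _ := GRing.SubChoice_isSubLmodule.Build
  R (T -> R) sns_pred supFun sns_submod.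

Implicit Types (f g : supFun) (x : T).

Definition supnorm f : R := sup [set `|f x| | x in [set: T]].

Lemma supFunP f : sns_set S f.
Proof. exact: set_mem (valP f). Qed.

Lemma le_supnorm f x : `|f x| <= supnorm f.
Proof.
apply: ub_le_sup; last by exists x.
by have [M fM] := sns_bounded (supFunP f); exists M => _ [y _ <-].
Qed.

Lemma supnorm_le f M : 0 <= M -> (forall x, `|f x| <= M) -> supnorm f <= M.
Proof.
move=> M0 fM; have [ne|/set0P ne] :=
  eqVneq [set `|f x| | x in [set: T]] set0; first by rewrite /supnorm ne sup0.
by apply: ge_sup => // _ [x _ <-].
Qed.

Lemma supnorm_ge0 f : 0 <= supnorm f.
Proof.
have [ne|/set0P[_ [x _ _]]] := eqVneq [set `|f x| | x in [set: T]] set0.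
  by rewrite /supnorm ne sup0.
exact: le_trans (normr_ge0 (f x)) (le_supnorm f x).
Qed.

Lemma supFunDE f g x : (f + g) x = f x + g x.
Proof. by []. Qed.

Lemma supFunNE f x : (- f) x = - f x.
Proof. by []. Qed.

Lemma supFunBE f g x : (f - g) x = f x - g x.
Proof. by []. Qed.

Lemma supFunZE (a : R) f x : (a *: f) x = a * f x.
Proof. by []. Qed.

Let supnormD f g : supnorm (f + g) <= supnorm f + supnorm g.
Proof.
apply: supnorm_le => [|x]; first by rewrite addr_ge0 ?supnorm_ge0.
by rewrite supFunDE (le_trans (ler_normD _ _))// lerD ?le_supnorm.
Qed.

Let supnormZ_le (a : R) f : supnorm (a *: f) <= `|a| * supnorm f.
Proof.
apply: supnorm_le => [|x]; first by rewrite mulr_ge0 ?supnorm_ge0.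
by rewrite supFunZE normrM ler_wpM2l ?le_supnorm.
Qed.

Let supnormZ (a : R) f : supnorm (a *: f) = `|a| * supnorm f.
Proof.
apply/eqP; rewrite eq_le supnormZ_le /=.
have [->|a0] := eqVneq a 0; first by rewrite normr0 mul0r supnorm_ge0.
rewrite -ler_pdivlMl ?normr_gt0// -normfV.
by rewrite -{1}[f]scale1r -(mulVf a0) -scalerA supnormZ_le.
Qed.

Let supnorm0_eq0 f : supnorm f = 0 -> f = 0.
Proof.
move=> f0; apply/val_inj/funext => x; apply/eqP.
by rewrite -normr_le0 -f0 le_supnorm.
Qed.

HB.instance Definition _ := Lmodule_isNormed.Build R supFun
  supnormD supnormZ supnorm0_eq0.

Lemma supFun_normE f : `|f| = sup [set `|f x| | x in [set: T]].
Proof. by []. Qed.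

Let supFun_complete (F : set_system supFun) :
  ProperFilter F -> cauchy F -> cvg F.
Proof.
move=> FF /cauchyP Fc.
have ev_cauchy x : cvg ((fun f : supFun => f x : R^o) @ F).
  apply: cauchy_cvg; apply/cauchyP => e e0.
  have [h Fh] := Fc e e0; exists (h x); rewrite /fmap/=.
  apply: filterS Fh => f; rewrite -!ball_normE/= => hf.
  by apply: le_lt_trans hf; rewrite -supFunBE; exact: le_supnorm.
pose l x : R := lim ((fun f : supFun => f x : R^o) @ F).
have near_l (e : R) : 0 < e ->
      F [set f : supFun | forall x, `|l x - f x| <= e].
  move=> e0; have [h Fh] := Fc (e / 2) (divr_gt0 e0 (ltr0n _ 2)).
  have lh x : `|l x - h x| <= e / 2.
    rewrite distrC; apply: (@closed_cvg _ _ F FF (fun f : supFun => f x : R^o)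
      [set y : R^o | `|h x - y| <= e / 2]).
    - rewrite (_ : [set y | _] = closed_ball_ Num.norm (h x) (e / 2)) //.
      exact: closed_closed_ball_.
    - apply: (filterS _ Fh) => g; rewrite -ball_normE/= => hg.
      by apply/ltW/(le_lt_trans _ hg); rewrite -supFunBE; exact: le_supnorm.
    - exact: ev_cauchy.
  apply: filterS Fh => f; rewrite -ball_normE/= => hf x.
  rewrite (splitr e) (le_trans (ler_distD (h x) _ _))// lerD//.
  by rewrite -supFunBE (le_trans (le_supnorm _ _))// ltW.
have Sl : sns_set S l.
  apply: sns_closed => e e0; have [f lf] := filter_ex (near_l e e0).
  by exists f => //; exact: supFunP.
pose L : supFun := SupFun (mem_set Sl).
apply/cvg_ex; exists L; apply/cvgrPdist_le => e e0.
apply: filterS (near_l e e0) => f lf.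
by apply: supnorm_le; [exact: ltW|exact: lf].
Qed.

HB.instance Definition _ := Uniform_isComplete.Build supFun supFun_complete.

End SupNorm.

Lemma uniform_dist_lt (R : realType) (T : Type) (F : set_system T)
    (FF : Filter F) (f : T -> R) (l : R) :
  (forall e, 0 < e -> exists g l',
    [/\ g @ F --> l', `|l - l'| <= e & forall x, `|f x - g x| <= e]) ->
  f @ F --> l.
Proof.
move=> H; apply/cvgrPdist_lt => e e0.
have e30 : 0 < e / 3 by rewrite divr_gt0.
have [g [l' [gl' ll' fg]]] := H _ e30.
near=> x.
have gx : `|l' - g x| < e / 3 by near: x; move/cvgrPdist_lt : gl'; exact.
have := fg x; rewrite distrC => fgx.
rewrite (_ : l - f x = (l - l') + (l' - g x) + (g x - f x)); last first.
  by rewrite subrKA [RHS]addrA subrK.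
have := ler_normD ((l - l') + (l' - g x)) (g x - f x).
have := ler_normD (l - l') (l' - g x); lra.
Unshelve. all: by end_near. Qed.

Section ContinuousFunctions.
Context (R : realType) (K : topologicalType) (cK : compact [set: K]).

Definition continuous_functions : set (K -> R) := [set f | continuous f].

Lemma continuous_functions0 : continuous_functions 0.
Proof. by move=> x; exact: cvg_cst. Qed.

Lemma continuous_functionsD f g :
  continuous_functions f -> continuous_functions g ->
  continuous_functions (f + g).
Proof. by move=> cf cg x; apply: cvgD; [exact: cf|exact: cg]. Qed.

Lemma continuous_functionsZ (a : R) f :
  continuous_functions f -> continuous_functions (a *: f).
Proof. by move=> cf x; apply: cvgZr; exact: cf. Qed.

Lemma continuous_functions_bounded f :
  continuous_functions f -> exists M, forall x, `|f x| <= M.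
Proof.
move=> cf; have /compact_bounded[M [_ fM]] : compact (f @` [set: K] : set R^o).
  by apply: continuous_compact => //; exact: continuous_subspaceT.
by exists (M + 1) => x; apply: (fM (M + 1)); [rewrite ltrDl|exists x].
Qed.

Lemma continuous_functions_closed f :
  (forall e, 0 < e ->
    exists2 g, continuous_functions g & forall x, `|f x - g x| <= e) ->
  continuous_functions f.
Proof.
move=> H x; apply: uniform_dist_lt => e /H[g cg fg].
by exists g, (g x); split => //; exact: cg.
Qed.

Definition continuous_space : supNormSpace R K :=
  SupNormSpace continuous_functions0 continuous_functionsD
    continuous_functionsZ continuous_functions_bounded
    continuous_functions_closed.

End ContinuousFunctions.

Section NullSequences.
Context (R : realType).

Definition null_sequences : set (nat -> R) := [set u | u @ \oo --> (0 : R)].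

Lemma null_sequences0 : null_sequences 0.
Proof. exact: cvg_cst. Qed.

Lemma null_sequencesD u v :
  null_sequences u -> null_sequences v -> null_sequences (u + v).
Proof. by move=> u0 v0; rewrite /null_sequences/= -(addr0 0); exact: cvgD. Qed.

Lemma null_sequencesZ (a : R) u : null_sequences u -> null_sequences (a *: u).
Proof.
by move=> u0; rewrite /null_sequences/= -(scaler0 _ a); exact: cvgZr.
Qed.

Lemma null_sequences_bounded u :
  null_sequences u -> exists M, forall n, `|u n| <= M.
Proof.
move=> u0; have /cvg_seq_bounded[M [_ uM]] : cvgn u by apply/cvg_ex; exists 0.
by exists (M + 1) => n; apply: uM; rewrite // ltrDl.
Qed.

Lemma null_sequences_closed u :
  (forall e, 0 < e ->
    exists2 v, null_sequences v & forall n, `|u n - v n| <= e) ->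
  null_sequences u.
Proof.
move=> H; apply: uniform_dist_lt => e e0; have [v v0 uv] := H e e0.
by exists v, 0; split => //; rewrite subrr normr0 ltW.
Qed.

Definition null_sequence_space : supNormSpace R nat :=
  SupNormSpace null_sequences0 null_sequencesD null_sequencesZ
    null_sequences_bounded null_sequences_closed.

End NullSequences.

(* Compactness of K is what makes the supremum norm finite on C(K). *)
Definition CK (R : realType) (K : topologicalType) (cK : compact [set: K]) :
    completeNormedModType R :=
  supFun (continuous_space R cK).

Definition c0 (R : realType) : completeNormedModType R :=
  supFun (null_sequence_space R).

Definition complemented (R : realType) (Z : normedModType R) (M : set Z) :
    Prop :=
  exists P : {linear Z -> Z},
    [/\ continuous P, forall z, P (P z) = P z & range P = M].

(* An exact sequence 0 -> Y -> Z -> X -> 0; by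
   [linear_bounded_continuous], continuity of a linear map is boundedness. *)
Record twisted_sum (R : realType) (Y X : completeNormedModType R) :=
  TwistedSum {
    ts_space : completeNormedModType R ;
    ts_in : {linear Y -> ts_space} ;
    ts_out : {linear ts_space -> X} ;
    ts_in_continuous : continuous ts_in ;
    ts_out_continuous : continuous ts_out ;
    ts_in_inj : injective ts_in ;
    ts_exact : range ts_in = ts_out @^-1` [set 0] ;
    ts_out_surj : range ts_out = [set: X] }.

Definition ts_trivial (R : realType) (Y X : completeNormedModType R)
    (E : twisted_sum Y X) : Prop :=
  complemented (range (ts_in E)).

(* Main.v *)
(* Under MA the continuum is regular, since every family of fewer than continuum
   many functions nat -> nat is dominated (Hechler forcing).  Regularity yields
   a closed subset of K consisting of continuum many isolated points e_b
   together with a single accumulation point x.  An almost disjoint family (A_b)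
   of subsets of nat then defines an operator C(K) -> l_infty/c_0 which sends g
   to a sequence converging to g(e_b) along A_b and to g(x) away from the A_b;
   its pullback is a twisted sum of c_0 and C(K).  A splitting of it is a
   bounded sequence of functionals phi_n on C(K) which recovers every A_b, up to
   a finite set, from the values phi_n(f_b) at bump functions f_b around e_b.
   Functionals on C(K) are countably supported because K is scattered of finite
   height, so there are only continuum many such arrays of values, and choosing
   each A_b among two almost disjoint candidates defeats them all. *)
Require Import Defs.
From HB Require Import structures.
From mathcomp Require Import all_boot all_order all_algebra.
From mathcomp Require Import finmap lra.
From mathcomp Require Import all_classical all_reals all_analysis.
Set Implicit Arguments.
Unset Strict Implicit.
Unset Printing Implicit Defensive.
Import Order.TTheory GRing.Theory Num.Theory.
Import numFieldNormedType.Exports.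
Local Open Scope classical_set_scope.
Local Open Scope card_scope.
Local Open Scope ring_scope.

(** * Cardinality of the continuum *)

Definition codable (T : Type) := exists f : T -> (nat -> bool), injective f.

Lemma codable_inj T U (f : T -> U) : injective f -> codable U -> codable T.
Proof. by move=> fI [g gI]; exists (g \o f); exact: inj_comp. Qed.

Lemma codable_cantor : codable (nat -> bool).
Proof. by exists id. Qed.

Lemma codable_bool : codable bool.
Proof. by exists (fun b _ => b) => a b /(congr1 (@^~ 0%N)). Qed.

Lemma codable_sequence T : codable T -> codable (nat -> T).
Proof.
move=> [f fI].
exists (fun (u : nat -> T) k =>
  if choice.unpickle k is Some (n, m) then f (u n) m else false) => u v uv.
apply/funext => n; apply: fI; apply/funext => m.
by have /= := congr1 (@^~ (choice.pickle (n, m))) uv; rewrite choice.pickleK.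
Qed.

Lemma codable_prod T U : codable T -> codable U -> codable (T * U).
Proof.
move=> [f fI] [g gI]; have := codable_sequence codable_cantor.
apply: (@codable_inj _ _ (fun x n => if n is 0%N then f x.1 else g x.2)).
move=> [a b] [c d] /= e; congr (_, _).
  by apply: fI; exact: (congr1 (fun h : nat -> nat -> bool => h 0%N) e).
by apply: gI; exact: (congr1 (fun h : nat -> nat -> bool => h 1%N) e).
Qed.

Lemma codable_option T : codable T -> codable (option T).
Proof.
move=> cT; have [f fI] := cT; have := codable_prod codable_bool codable_cantor.
apply: (@codable_inj _ _
  (fun o => if o is Some x then (true, f x) else (false, fun=> false))).
by move=> [x|] [y|] //= [] /fI ->.
Qed.

Lemma codable_seq T : codable T -> codable (seq T).
Proof.
move=> /codable_option/codable_sequence; apply: (@codable_inj _ _ (@onth T)).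
by move=> s t e; apply: eq_from_onth => i; rewrite e.
Qed.

Lemma codable_nat : codable nat.
Proof.
apply: (@codable_inj _ _ (fun n => nseq n true)).
  by move=> m n /(congr1 size); rewrite !size_nseq.
exact: codable_seq codable_bool.
Qed.

Lemma codable_real (R : realType) : codable R.
Proof.
exists (fun r k =>
  if choice.unpickle k is Some q then ratr q < r else false) => r s.
wlog rs : r s / r < s.
  by move=> H e; have [/H->|/H->|] := ltgtP r s.
move=> /[dup] e _; have [q] := rat_in_itvoo rs.
rewrite in_itv /= => /andP[rq qs].
have := congr1 (@^~ (choice.pickle q)) e; rewrite choice.pickleK qs.
by move=> /(lt_trans rq); rewrite ltxx.
Qed.

Section CantorToReal.
Context (R : realType).
Implicit Types b : nat -> bool.

(** Base-3 expansions with digits 0 and 1: the first digit where two of them differ is worth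
    [3 * t n.+1], more than the [3 / 2 * t n.+1] that all later digits can contribute. *)
Let P b n : R := \sum_(k < n) (b k)%:R * 3^-1 ^+ k.
Let t n : R := 3^-1 ^+ n.

Let tS n : t n = 3 * t n.+1.
Proof. by rewrite /t exprS mulrA divff ?mul1r. Qed.

Let t_gt0 n : 0 < t n.
Proof. by rewrite exprn_gt0// invr_gt0. Qed.

Let PS b n : P b n.+1 = P b n + (b n)%:R * t n.
Proof. by rewrite /P big_ord_recr. Qed.

Let P_le b n m : P b (n + m) + 3 / 2 * t (n + m) <= P b n + 3 / 2 * t n.
Proof.
elim: m => [|m IH]; rewrite ?addn0// addnS; apply: le_trans IH.
have := tS (n + m); have := t_gt0 (n + m).+1; rewrite PS.
by case: (b _) => /=; lra.
Qed.

Let P_homo b n m : P b n <= P b (n + m).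
Proof.
elim: m => [|m IH]; rewrite ?addn0// addnS (le_trans IH)//.
by rewrite PS lerDl mulr_ge0// ltW.
Qed.

Let x b := sup (range (P b)).

Let P_ub b n k : P b k <= P b n + 3 / 2 * t n.
Proof.
have := t_gt0 n; have := t_gt0 k; have [/subnKC <-|/ltnW/subnKC <-] := leqP n k.
  by have := P_le b n (k - n); have := t_gt0 (n + (k - n)); lra.
by have := P_homo b k (n - k); lra.
Qed.

Let x_ge b n : P b n <= x b.
Proof.
by apply: ub_le_sup; [exists (P b 0 + 3 / 2 * t 0) => _ [k _ <-]|exists n].
Qed.

Let x_le b n : x b <= P b n + 3 / 2 * t n.
Proof. by apply: ge_sup; [exists (P b 0), 0%N|move=> _ [k _ <-]]. Qed.

Lemma cantor_to_real : exists f : (nat -> bool) -> R, injective f.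
Proof.
exists x => a b xab; apply: contrapT => ab.
have /existsNP[n0 /eqP/= n0P] : ~ forall n, a n = b n.
  by move=> H; apply/ab/funext.
have exP : exists n, a n != b n by exists n0.
case: (ex_minnP exP) => n abn nmin.
have Pab : P a n = P b n.
  apply: eq_bigr => i _; congr ((nat_of_bool _)%:R * _).
  by apply/eqP; apply: contraTT (ltn_ord i) => abi; rewrite -leqNgt nmin.
move: xab abn; have := x_ge a n.+1; have := x_ge b n.+1.
have := x_le a n.+1; have := x_le b n.+1; rewrite !PS Pab.
have := tS n; have := t_gt0 n.+1.
by case: (a n); case: (b n) => //=; lra.
Qed.

End CantorToReal.

Lemma cantor_card_leP T (A : set T) :
  [set: nat -> bool] #<= A <->
  exists2 f : (nat -> bool) -> T, injective f & forall b, A (f b).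
Proof.
split=> [|[f fI fA]].
  elim/Ppointed: T => T in A *.
    by rewrite emptyE => /eqP/seteqP[/(_ (fun=> true))/=] /(_ Logic.I).
  move=> /pcard_leP/injfunPex[f fA fI]; exists f; last by move=> b; exact: fA.
  by move=> a b; apply: fI; rewrite inE.
suff [f'] : $|{injfun [set: nat -> bool] >-> A}| by exact: (inj_card_le f').
by apply/injfunPex; exists f => // a b _ _; exact: fI.
Qed.

(** Cardinality below the continuum, stated negatively. *)
Definition small T (A : set T) := ~ ([set: nat -> bool] #<= A).

Lemma small_le T U (A : set T) (B : set U) : A #<= B -> small B -> small A.
Proof. by move=> AB sB BA; apply: sB; exact: card_le_trans AB. Qed.

Lemma small_sub T (A B : set T) : A `<=` B -> small B -> small A.
Proof. by move=> AB; apply: small_le; exact: subset_card_le. Qed.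

Lemma countable_small T (A : set T) : countable A -> small A.
Proof.
move=> cA BA; have /cantor_card_leP[f fI _] := card_le_trans BA cA.
(* Cantor's diagonal: [g] holds at [f b] iff [b] fails there, which is absurd for [b = g]. *)
pose g n : bool := `[< exists2 b, f b = n & ~~ b n >].
have [gf|/negP gf] := boolP (g (f g)).
  by have /asboolP[b /fI bg /negP[]] := gf; rewrite bg.
by apply: (gf); apply/asboolP; exists g => //; apply/negP.
Qed.

(** Cantor space splits into continuum many copies of itself; a countable set meets only countably
    many of them, so one copy lies in [A]. *)
Lemma small_setU_countable T (A C : set T) :
  small A -> countable C -> small (A `|` C).
Proof.
move=> sA cC /cantor_card_leP[f fI fAC]; apply: sA.
have [p pI] := codable_prod codable_cantor codable_cantor.
pose q a b := f (p (a, b)).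
have qI a b a' b' : q a b = q a' b' -> a = a' /\ b = b'.
  by move=> /fI/pI[].
have cD : countable [set a | exists b, C (q a b)].
  have : [set a | exists b, C (q a b)] `<=`
      (fun t => xget (fun=> true) [set a | exists b, q a b = t]) @` C.
    move=> a /= [b Cab]; exists (q a b) => //=.
    by case: xgetP => [a' _ [b' /qI[]]|/(_ a) []]; last exists b.
  move=> /subset_card_le /card_le_trans; apply.
  exact: card_le_trans (card_image_le _ _) cC.
have [a aP] : exists a, ~ exists b, C (q a b).
  apply: contrapT => /forallNP H; apply: (countable_small cD).
  by apply: subset_card_le => a _ /=; exact: contrapT (H a).
apply/cantor_card_leP; exists (q a) => [b b' /qI[]//|b].
by case: (fAC (p (a, b))) => // Cab; case: aP; exists b.
Qed.

(** * Hechler forcing and unions of fewer than continuum many sets *)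

(* A condition (s, f) promises a function extending s that dominates f beyond
   the domain of s. *)
Definition hechler : Type := seq nat * (nat -> nat).
HB.instance Definition _ := Choice.on hechler.

Section Hechler.
Implicit Types p q r : hechler.

Definition hechler_le p q : bool := `[< [/\ prefix q.1 p.1,
  forall n, (q.2 n <= p.2 n)%N &
  forall n, (size q.1 <= n < size p.1)%N -> (q.2 n <= nth 0 p.1 n)%N] >].

Lemma hechler_le_refl : reflexive hechler_le.
Proof.
move=> p; apply/asboolP; split=> [||n /andP[/leq_ltn_trans/[apply]]] //.
  exact: prefix_refl.
by rewrite ltnn.
Qed.

Lemma hechler_le_anti : antisymmetric hechler_le.
Proof.
move=> [s f] [t g] /= /andP[/asboolP[/= ts gf _] /asboolP[/= st fg _]].
congr (_, _); last by apply/funext => n; apply/eqP; rewrite eqn_leq fg gf.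
have := size_prefix st; rewrite leq_eqVlt ltnNge size_prefix// orbF => /eqP sz.
move/prefixP: st sz => [u ->]; rewrite size_cat -{1}(addn0 (size s)).
by move=> /addnI/esym/size0nil ->; rewrite cats0.
Qed.

Lemma hechler_le_trans : transitive hechler_le.
Proof.
move=> q p r /asboolP[qp fqp gqp] /asboolP[rq frq grq]; apply/asboolP; split.
- exact: prefix_trans qp.
- by move=> n; exact: leq_trans (fqp n).
move=> n /andP[rn np]; have [nq|qn] := ltnP n (size q.1).
  have := grq n; rewrite rn nq => /(_ isT) /leq_trans; apply.
  by case/prefixP: qp => u ->; rewrite nth_cat nq.
by apply: leq_trans (frq n) _; apply: gqp; rewrite qn np.
Qed.

HB.instance Definition _ := Order.Le_isPOrder.Build (Order.Disp tt tt) hechler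
  hechler_le_refl hechler_le_anti hechler_le_trans.

(* Conditions with the same stem are compatible. *)
Lemma ccc_hechler : ccc hechler.
Proof.
move=> A Aanti; apply/countable_injP; exists (fun p => choice.pickle p.1).
move=> p q /set_mem Ap /set_mem Aq e.
have {e}pq1 : p.1 = q.1 := pcan_inj choice.pickleK e.
apply: contrapT => pq; apply: (Aanti _ _ Ap Aq pq).
exists (p.1, fun n => maxn (p.2 n) (q.2 n)); split; apply/asboolP; split => /=.
- exact: prefix_refl.
- by move=> n; rewrite leq_maxl.
- by move=> n /andP[/leq_ltn_trans/[apply]]; rewrite ltnn.
- by rewrite pq1 prefix_refl.
- by move=> n; rewrite leq_maxr.
- by move=> n; rewrite pq1 => /andP[/leq_ltn_trans/[apply]]; rewrite ltnn.
Qed.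

End Hechler.

(** The stems of a sufficiently generic filter glue to one function. Meeting every [E m] makes them
    arbitrarily long, and a condition in [D h] forces the function above [h] beyond its own stem. *)
Lemma martin_axiom_dominating (R : realType) (X : set (nat -> nat)) :
  martin_axiom R -> small X ->
  exists g, forall h, X h -> exists N, forall n, (N <= n)%N -> (h n <= g n)%N.
Proof.
move=> MA sX.
pose D h : set hechler := [set p | forall n, (h n <= p.2 n)%N].
pose E m : set hechler := [set p | (m <= size p.1)%N].
pose DD := D @` X `|` range E.
have sDD : small DD.
  apply: small_setU_countable.
    by apply: small_le sX; exact: card_image_le.
  exact: card_le_trans (card_image_le _ _) _.
have dense d : DD d -> order_dense d.
  case=> [[h _ <-] [s f]|[m _ <-] [s f]].
    exists (s, fun n => maxn (f n) (h n)) => /=.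
      by move=> n; rewrite leq_maxr.
    apply/asboolP; split => /= [|n|n]; rewrite ?prefix_refl ?leq_maxl//.
    by move=> /andP[/leq_ltn_trans/[apply]]; rewrite ltnn.
  (* The new entries are the promised lower bounds themselves, so the longer stem obeys [f]. *)
  exists (s ++ mkseq (fun n => f (size s + n)%N) m, f).
    by rewrite /E/= size_cat size_mkseq leq_addl.
  apply/asboolP; split => /= [|n|n]; rewrite ?prefix_prefix//.
  rewrite size_cat size_mkseq => /andP[sn nm].
  by rewrite nth_cat ltnNge sn/= nth_mkseq ?subnKC// ltn_subLR.
have [f fI] := cantor_to_real R.
have BR : [set: nat -> bool] #<= [set: R] by apply/cantor_card_leP; exists f.
have DDR : card_lt DD [set: R].
  apply/andP; split; last first.
    by apply/negP; move=> /card_eqPle[_ e]; exact: sDD (card_le_trans BR e).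
  have [k kI] : codable (option nat * (nat -> nat)).
    apply: codable_prod; first exact: codable_option codable_nat.
    exact: codable_sequence codable_nat.
  pose c x := if x is (Some m, _) then E m else D x.2.
  have : DD `<=` range c.
    by move=> _ [[h _ <-]|[m _ <-]]; [exists (None, h)|exists (Some m, id)].
  move=> /subset_card_le/card_le_trans; apply.
  apply: card_le_trans (card_image_le _ _) _.
  by apply/pcard_leTP/injPex; exists (f \o k) => a b _ _ /fI/kI.
have hechlerT : [set: hechler] !=set0 by exists ([::], id).
have [G [_ _ Gdir] GD] := MA _ hechler hechlerT ccc_hechler DD DDR dense.
have Gext n : exists p, G p /\ (n < size p.1)%N.
  by have [|p [Gp pn]] := GD (E n.+1); [right; exists n.+1|exists p].
pose st n := projT1 (cid (Gext n)).
have stG n : G (st n) /\ (n < size (st n).1)%N by exact: projT2 (cid (Gext n)).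
exists (fun n => nth 0%N (st n).1 n) => h Xh.
have [|p [Gp ph]] := GD (D h); first by left; exists h.
exists (size p.1) => n pn; have [Gs sn] := stG n.
(* The stem supplying the value at [n] is a prefix of that of [r], where the promise of [p] is in
   force. *)
have [r [_ /asboolP[/= rp _ gp] /asboolP[/= rs _ _]]] := Gdir _ _ Gp Gs.
have snr : (n < size r.1)%N by apply: leq_trans sn (size_prefix rs).
apply: (leq_trans (ph n)); apply: leq_trans (gp n _) _; first by rewrite pn.
by case/prefixP: rs => u ->; rewrite nth_cat sn.
Qed.

(* Regularity of the continuum: identify T with a subset of nat -> nat; each
   piece is dominated by one function, and these functions by a single one. *)
Lemma small_bigcup (R : realType) I T (Y : set I) (F : I -> set T) :
  martin_axiom R -> small Y -> (forall i, Y i -> small (F i)) ->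
  small (\bigcup_(i in Y) F i).
Proof.
move=> MA sY sF /cantor_card_leP[f fI fF].
have [k kI] := codable_sequence codable_nat.
pose H i := [set h | F i (f (k h))].
have gP i : exists g, Y i ->
    forall h, H i h -> exists N, forall n, (N <= n)%N -> (h n <= g n)%N.
  have [Yi|] := pselect (Y i); last by exists id.
  have [|g gP] := @martin_axiom_dominating R (H i) MA; last by exists g.
  move=> /cantor_card_leP[b bI bH]; apply: (sF _ Yi); apply/cantor_card_leP.
  by exists (f \o k \o b) => // x y /= /fI/kI/bI.
pose g i := projT1 (cid (gP i)).
have sg : small (g @` Y) by apply: small_le sY; exact: card_image_le.
have [G GP] := martin_axiom_dominating MA sg.
(* The point coded by the successor of [G] lies in some piece, so this successor is eventually below
   [g i] and hence below [G], which is absurd. *)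
have [i Yi Hi] := fF (k (fun n => (G n).+1)).
have [N NP] := projT2 (cid (gP i)) Yi _ Hi.
have [|M MP] := GP (g i); first by exists i.
have := leq_trans (NP (maxn N M) (leq_maxl _ _)) (MP _ (leq_maxr _ _)).
by rewrite ltnn.
Qed.

Lemma small_setU (R : realType) T (A B : set T) :
  martin_axiom R -> small A -> small B -> small (A `|` B).
Proof.
move=> MA sA sB.
apply: (@small_sub _ _ (\bigcup_(b in [set: bool]) (if b then A else B))).
  by move=> x [Ax|Bx]; [exists true|exists false].
by apply: (small_bigcup MA) => [|[]//]; exact: countable_small.
Qed.

Lemma small_seq (R : realType) T (A : set T) :
  martin_axiom R -> small A ->
  small [set s : seq T | forall x, List.In x s -> A x].
Proof.
move=> MA sA.
pose S n := [set s : seq T | size s = n /\ forall x, List.In x s -> A x].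
suff sS n : small (S n).
  apply: (@small_sub _ _ (\bigcup_(n in [set: nat]) S n)).
    by move=> s As; exists (size s).
  by apply: (small_bigcup MA) => [|n _]; [exact: countable_small|exact: sS].
elim: n => [|n IH].
  apply: countable_small; apply: (@card_le_trans _ _ _ [set [::]]).
    by apply: subset_card_le => s [/size0nil].
  exact: countable1.
apply: (@small_sub _ _ (\bigcup_(x in A) [set x :: s | s in S n])).
  move=> [|x s] [//= [sn] sA']; exists x; first by apply: sA'; left.
  by exists s => //; split=> // y ys; apply: sA'; right.
apply: (small_bigcup MA) => // x _.
by apply: small_le IH; exact: card_image_le.
Qed.

(** * A closed one-point compactification of a large discrete set *)

(** Compactness as an induction principle. If the whole space fails [P], the complements of the sets
    with [P] form a proper filter, which cannot cluster at a point having a neighbourhood with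
    [P]. *)
Lemma compact_ind (K : topologicalType) (P : set K -> Prop) :
  compact [set: K] -> P set0 -> (forall A B, A `<=` B -> P B -> P A) ->
  (forall A B, P A -> P B -> P (A `|` B)) ->
  (forall z : K, exists2 U, nbhs z U & P U) -> P [set: K].
Proof.
move=> cK P0 PS PU Pl; apply: contrapT => PT.
pose F : set_system K := [set U | P (~` U)].
have FF : ProperFilter F.
  apply: Build_ProperFilter_ex; last split.
  - move=> U FU; apply: contrapT => /forallNP U0; apply: PT.
    by apply: PS FU => z _; exact: U0.
  - by rewrite /F/= setCT.
  - by move=> A B FA FB; rewrite /F/= setCI; exact: PU.
  - by move=> A B AB; apply: PS; exact: subsetC.
have [z [_ zF]] : [set: K] `&` cluster F !=set0 by apply: cK; exact: filterT.
have [U zU PzU] := Pl z.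
have FU : F (~` U) by rewrite /F/= setCK.
by have [y []] := zF _ _ FU zU.
Qed.

(* Finite intersections of separating open sets form a base of a compact
   Hausdorff space, so an infinite one has at least as many points as its
   weight. *)
Lemma weight_large (R : realType) (K : topologicalType) :
  martin_axiom R -> compact [set: K] -> hausdorff_space K ->
  weight_ge K [set: R] -> ~ small [set: K].
Proof.
move=> MA cK hK wK sK.
have sepP (p : K * K) : exists U : set K * set K, p.1 != p.2 ->
    [/\ open U.1, open U.2, U.1 p.1, U.2 p.2 & U.1 `&` U.2 = set0].
  have [pp|pp] := eqVneq p.1 p.2; first by exists (setT, setT).
  move: hK; rewrite open_hausdorff => /(_ _ _ pp)[U [/set_mem ? /set_mem ?]].
  by move=> [? ? /eqP]; exists U.
pose U p := projT1 (cid (sepP p)); have UP p := projT2 (cid (sepP p)).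
pose A := [set p : K * K | p.1 != p.2].
pose S := [set s | forall p, List.In p s -> A p].
pose B s := [set z | forall p, List.In p s -> (U p).1 z].
have sS : small S.
  apply: (small_seq MA).
  apply: (@small_sub _ _ (\bigcup_(y in [set: K]) ((pair y) @` [set: K]))).
    by move=> [y z] _; exists y => //; exists z.
  apply: (small_bigcup MA) => [|y _]; first exact: sK.
  by apply: small_le sK; exact: card_image_le.
suff bB : basis (B @` S).
  have [f fI] := cantor_to_real R.
  have BR : [set: nat -> bool] #<= [set: R] by apply/cantor_card_leP; exists f.
  apply: sS (card_le_trans BR (card_le_trans (wK _ bB) _)).
  exact: card_image_le.
split=> [_ [s sA <-]|x V].
  elim: s sA => [|p s IH] sA.
    rewrite (_ : B [::] = setT); first exact: openT.
    by apply/seteqP; split=> z // _ p [].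
  rewrite (_ : B (p :: s) = (U p).1 `&` B s); last first.
    apply/seteqP; split=> z => [Bz|[pz Bz] q [<-//|]]; last exact: Bz.
    by split=> [|q qs]; apply: Bz; [left|right].
  apply: openI; last by apply: IH => q qs; apply: sA; right.
  by have [] := UP p (sA p (or_introl erefl)).
rewrite nbhsE => -[N [openN Nx] NV].
suff [s Ss [Bx BN]] : exists2 s, S s & B s x /\ B s `&` setT `<=` N.
  exists (B s); first by split=> //; exists s.
  by move=> z Bz; apply/NV/BN.
pose P W := exists2 s, S s & B s x /\ B s `&` W `<=` N.
apply: (@compact_ind K P cK) => [|C D CD [s Ss [Bx BN]]|C D|z].
- by exists [::] => //; split=> // z [].
- by exists s => //; split=> // z [Bz Cz]; apply: BN; split=> //; exact: CD.
- move=> [s Ss [Bsx BsN]] [t St [Btx BtN]]; exists (s ++ t).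
    by move=> p pst; case: (List.in_app_or s t p pst); [exact: Ss|exact: St].
  split.
    by move=> p pst; case: (List.in_app_or s t p pst); [exact: Bsx|exact: Btx].
  move=> z [Bz [Cz|Dz]].
    by apply: BsN; split=> // p ps; apply/Bz/List.in_or_app; left.
  by apply: BtN; split=> // p ps; apply/Bz/List.in_or_app; right.
have [Nz|nNz] := pselect (N z).
  exists N; first exact: open_nbhs_nbhs.
  by exists [::] => //; split=> // y [].
have xz : x != z by apply/eqP => xz; rewrite -xz in nNz.
have [/= oU1 oU2 U1 U2 U12] := UP (x, z) xz.
exists (U (x, z)).2; first exact: open_nbhs_nbhs.
exists [:: (x, z)]; first by move=> p [<-|[]].
split=> [p [<-|[]]//|y [By U2y]].
suff : set0 y by [].
by rewrite -U12; split=> //; exact: By (x, z) (or_introl erefl).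
Qed.

Section CantorBendixson.
Context (K : topologicalType).

Lemma closed_nbhsC (A : set K) z : closed A -> ~ A z -> nbhs z (~` A).
Proof. by move=> /closed_openC oA nAz; apply: open_nbhs_nbhs; split. Qed.

(** A point of [S] has a neighbourhood meeting [A] in that point alone. Applied both to all isolated
    points and to a single one. *)
Lemma closed_setD_isolated (A S : set K) :
  closed A -> S `<=` isolated A -> closed (A `\` S).
Proof.
move=> cA SA; rewrite -openC openE => z nz.
have [Az|nAz] := pselect (A z); last first.
  by apply: filterS (closed_nbhsC cA nAz); apply: subsetC => y [].
have Sz : S z by apply: contrapT => nSz; apply: nz.
have [_ [V zV VA]] := SA _ Sz.
apply: filterS zV => y Vy [Ay nSy].
have : (V `&` A) y by []. 
by rewrite VA => yz; apply: nSy; rewrite yz.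
Qed.

Lemma closed_cb_derivative n : closed (cb_derivative K n).
Proof. by elim: n => [|n IH]; [exact: closedT|exact: closed_setD_isolated]. Qed.

End CantorBendixson.

Lemma large_discrete_family (R : realType) (K : topologicalType) :
  martin_axiom R -> compact [set: K] -> hausdorff_space K ->
  scattered_finite_height K -> ~ small [set: K] ->
  exists (e : (nat -> bool) -> K) (x : K) (f : (nat -> bool) -> K -> R),
    [/\ forall b, continuous (f b), forall b, f b (e b) = 1,
        forall b b', b <> b' -> f b (e b') = 0, forall b, f b x = 0 &
        forall g : K -> R, continuous g -> forall eps, 0 < eps ->
          finite_set [set b | eps <= `|g (e b) - g x|]].
Proof.
move=> MA cK hK [n [Kn _]] lK.
(* The derivatives pass from large to small at stage [i]; by regularity, the points lost there,
   those isolated in [F], form a large set. *)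
have [i [lF sF']] : exists i,
    ~ small (cb_derivative K i) /\ small (cb_derivative K i.+1).
  have : small (cb_derivative K n) by rewrite Kn; exact: countable_small.
  elim: n {Kn} => [//|n IH] sn.
  by have [/IH//|ln] := pselect (small (cb_derivative K n)); exists n.
set F := cb_derivative K i in lF sF'; pose I := isolated F.
have cF : closed F by exact: closed_cb_derivative.
have lI : ~ small I.
  move=> sI; apply: lF; apply: small_sub (small_setU MA sI sF') => z Fz.
  by have [|] := pselect (isolated F z); [left|right].
(* A point x of X0 that is isolated in X0 has a neighbourhood W on which every
   other point sees only few points of I; removing from W the neighbourhoods of
   the few non-isolated points leaves a large set accumulating only at x. *)
pose X0 : set K := [set z : K | forall U, nbhs z U -> ~ small (U `&` I)].
have [x0 X0x0] : X0 !=set0.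
  apply: contrapT => /forallNP X00; apply: lI; rewrite -[I]setTI.
  apply: (@compact_ind K (fun U => small (U `&` I)) cK).
  - by rewrite set0I; exact: countable_small.
  - by move=> A B AB; apply: small_sub; exact: setSI.
  - by move=> A B sA sB; rewrite setIUl; exact: (small_setU MA).
  move=> z; have /existsNP[U /not_implyP[zU /contrapT sU]] := X00 z.
  by exists U.
(* Finite height yields the last derivative containing [X0]; a point of [X0] lost at the next stage
   is isolated in it, hence in [X0]. *)
have [j [X0j X0j']] : exists j,
    X0 `<=` cb_derivative K j /\ ~ X0 `<=` cb_derivative K j.+1.
  have : ~ X0 `<=` cb_derivative K n by rewrite Kn => /(_ x0); apply.
  elim: n {Kn} => [|n IH] nX; first by case: nX.
  have [Xn|/IH//] := pselect (X0 `<=` cb_derivative K n); by exists n.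
have /existsNP[x /not_implyP[X0x nKx]] := X0j'.
have [V xV Vx] : exists2 V, nbhs x V & V `&` cb_derivative K j = [set x].
  have /not_andP[/(_ (X0j _ X0x))//|/contrapT[_ //]] := nKx.
have Fx : F x.
  apply: contrapT => nFx; apply: (X0x _ (closed_nbhsC cF nFx)).
  apply: countable_small; rewrite (_ : _ `&` _ = set0)//.
  by rewrite -subset0 => z [nFz /isolatedS].
have nIx : ~ I x.
  move=> [_ [U xU UF]]; apply: (X0x _ xU); apply: countable_small.
  apply: (@card_le_trans _ _ _ [set x]); last exact: countable1.
  by apply: subset_card_le; rewrite -UF => z [Uz /isolatedS].
have [W xW WV] : exists2 W, nbhs x W & closure W `<=` V.
  by have := compact_regular hK cK filterT; apply.
(* Points of [Y] are not in [X0], since [V] meets [X0] only in [x]. As [Y] is small along with the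
   derivative [i.+1], regularity keeps [G] large. *)
pose Y := [set y | [/\ cb_derivative K i.+1 y, closure W y & y <> x]].
have UP y : exists U, Y y -> nbhs y U /\ small (U `&` I).
  have [[F'y Wy yx]|] := pselect (Y y); last by exists setT.
  have /existsNP[U /not_implyP[yU /contrapT sU]] : ~ X0 y.
    move=> X0y; apply: yx; suff : [set x] y by [].
    by rewrite -Vx; split; [exact: WV|exact: X0j].
  by exists U.
pose U y := projT1 (cid (UP y)); have UP' y := projT2 (cid (UP y)).
pose G := (W `&` I) `\` \bigcup_(y in Y) (U y `&` I).
have /cantor_card_leP[e eI eG] : [set: nat -> bool] #<= G.
  apply: contrapT => sG; apply: (X0x _ xW).
  have sY : small (\bigcup_(y in Y) (U y `&` I)).
    apply: (small_bigcup MA) => [|y /UP'[]//].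
    by apply: small_sub sF' => y [].
  apply: small_sub (small_setU MA sG sY) => z WIz.
  by have [|] := pselect ((\bigcup_(y in Y) (U y `&` I)) z); [right|left].
(* Away from [x], every point has a neighbourhood meeting [G] in at most one point; near [x],
   continuity keeps [g] close to [g x]. *)
have finE (g : K -> R) : continuous g -> forall eps, 0 < eps ->
    finite_set (G `&` [set z | eps <= `|g z - g x|]).
  move=> cg eps eps0; set E := _ `&` _; rewrite -[E]setTI.
  apply: (@compact_ind K (fun U => finite_set (U `&` E)) cK).
  - by rewrite set0I.
  - by move=> A B AB; apply: sub_finite_set; exact: setSI.
  - by move=> A B sA sB; rewrite setIUl finite_setU.
  have GF z : G z -> F z by move=> [[_ /isolatedS]].
  move=> z; have [Fz|nFz] := pselect (F z); last first.
    exists (~` F); first exact: closed_nbhsC.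
    by rewrite (_ : _ `&` _ = set0)// -subset0 => y [nFy [/GF]].
  have [[_ [Z zZ ZF]]|nIz] := pselect (I z).
    exists Z => //; apply: sub_finite_set (finite_set1 z).
    by rewrite -ZF => y [Zy [/GF]].
  have [->|/eqP zx] := eqVneq z x.
    exists [set y | `|g x - g y| < eps].
      by have /cvgrPdist_lt := cg x; exact.
    rewrite (_ : _ `&` _ = set0)// -subset0 => y [/=]; rewrite distrC ltNge.
    by move=> /negP gy [_ /gy].
  have [Wz|nWz] := pselect (closure W z).
    have Yz : Y z by split=> //; split.
    have [zU _] := UP' z Yz; exists (U z) => //.
    rewrite (_ : _ `&` _ = set0)// -subset0 => y [Uy [[[_ Iy] nUy] _]].
    by apply: nUy; exists z.
  exists (~` closure W); first exact: closed_nbhsC (@closed_closure _ W) nWz.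
  rewrite (_ : _ `&` _ = set0)// -subset0 => y [nWy [[[/subset_closure]]]].
  by [].
(* Urysohn's lemma separates [e b], isolated in [F], from the closed set of the other points of
   [F]. *)
have fP b : exists f : K -> R, [/\ continuous f, f (e b) = 1 &
    forall z, F z -> z <> e b -> f z = 0].
  have [[_ Ie] _] := eG b.
  have cFe : closed (F `\` [set e b]) by apply: closed_setD_isolated => // _ ->.
  have ce : closed [set e b].
    by apply: accessible_closed_set1; exact: hausdorff_accessible.
  have F0 : (F `\` [set e b]) `&` [set e b] = set0.
    by rewrite -subset0 => z [[_ ]].
  have := (@normal_separatorP R K).1 (compact_normal hK cK) _ _ cFe ce F0.
  move=> /(@uniform_separatorP _ R)[f [cf _ f0 f1]]; exists f; split=> //.
    by apply: f1; exists (e b).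
  by move=> z Fz zb; apply: f0; exists z.
pose f b := projT1 (cid (fP b)); have fP' b := projT2 (cid (fP b)).
exists e, x, f; split.
- by move=> b; have [] := fP' b.
- by move=> b; have [] := fP' b.
- move=> b b' bb'; have [_ _] := fP' b; apply.
    by have [[_ /isolatedS]] := eG b'.
  by move=> /eI/esym.
- move=> b; have [_ _] := fP' b; apply=> // xb; apply: nIx; rewrite xb.
  by have [[]] := eG b.
move=> g cg eps /(finE g cg) fE.
have : finite_set (e @^-1` (G `&` [set z | eps <= `|g z - g x|])).
  by apply: finite_preimage fE => a b _ _ /eI.
by apply: sub_finite_set => b /= gb; split.
Qed.

(** * Counting bounded functionals *)

(** A countable set is coded through a chosen enumeration with gaps. *)
Lemma codable_countable_subsets T : codable T ->
  exists enc : set T -> (nat -> bool), forall D D',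
    countable D -> countable D' -> enc D = enc D' -> D = D'.
Proof.
move=> /codable_option/codable_sequence[j jI].
have sP (D : set T) : exists s : nat -> option T,
    countable D -> D = [set t | exists k, s k = Some t].
  have [/countable_injP[f fI]|] := pselect (countable D); last first.
    by exists (fun=> None).
  exists (fun k => if pselect (exists2 u, D u & f u = k) is left e
    then Some (projT1 (cid2 e)) else None) => _.
  apply/seteqP; split=> [t Dt|t [k]] /=.
    exists (f t); case: pselect => [e|[]]; last by exists t.
    by case: cid2 => u Du /= /fI ->//; exact: mem_set.
  by case: pselect => // e [<-]; case: cid2.
exists (fun D => j (projT1 (cid (sP D)))) => D D' cD cD' /jI e.
by rewrite (projT2 (cid (sP D)) cD) (projT2 (cid (sP D')) cD') e.
Qed.

Section CountingFunctionals.
Context (R : realType) (K : topologicalType) (cK : compact [set: K]).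
Context (B : choiceType) (f : B -> CK R cK).
Implicit Types (g u v : CK R cK) (phi psi : CK R cK -> R) (y p : K).

Definition eqv y p := forall b, f b y = f b p.

Lemma eqv_sym y p : eqv y p -> eqv p y.
Proof. by move=> yp b. Qed.

Lemma eqv_trans p y q : eqv y p -> eqv p q -> eqv y q.
Proof. by move=> yp pq b; rewrite yp. Qed.

Definition class_invariant g := forall y p, eqv y p -> g y = g p.

Lemma CK_sumE (I : Type) (s : seq I) (a : I -> R) (u : I -> CK R cK) y :
  (\sum_(i <- s) a i *: u i) y = \sum_(i <- s) a i * u i y.
Proof. exact: (big_morph (fun g => g y)). Qed.

Definition is_functional phi :=
  forall a u v, phi (a *: u + v) = a * phi u + phi v.

Lemma functional0 phi : is_functional phi -> phi 0 = 0.
Proof.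
by move=> lphi; have := lphi 1 0 0; rewrite scaler0 addr0 mul1r; lra.
Qed.

Lemma functional_sum phi (I : Type) (s : seq I) (a : I -> R)
    (u : I -> CK R cK) :
  is_functional phi ->
  phi (\sum_(i <- s) a i *: u i) = \sum_(i <- s) a i * phi (u i).
Proof.
move=> lphi; elim: s => [|i s IH]; first by rewrite !big_nil functional0.
by rewrite !big_cons lphi IH.
Qed.

(* For class-invariant functions: phi is bounded and depends only on the
   restriction to the n-th derivative of K. *)
Definition level_bounded n phi := is_functional phi /\
  exists c, forall g, class_invariant g -> forall M, 0 <= M ->
    (forall y, cb_derivative K n y -> `|g y| <= M) -> `|phi g| <= c * M.

(* The points of K are too many to be coded when #|K| exceeds the continuum, but
   a class of eqv isolated from the others at a given level is the zero set of
   a finite combination of the functions |f_b - v|. *)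
Definition code := seq (B * R * R).

Definition code_dist (t : code) y :=
  \sum_(x <- t) `|x.1.2| * `|f x.1.1 y - x.2|.

Lemma code_dist_ge0 t y : 0 <= code_dist t y.
Proof. by apply: sumr_ge0 => x _; rewrite mulr_ge0. Qed.

Lemma code_dist_eqv t y p : eqv y p -> code_dist t y = code_dist t p.
Proof. by move=> yp; apply: eq_bigr => x _; rewrite yp. Qed.

Lemma CK_continuous g : continuous (g : K -> R).
Proof. exact: (supFunP g). Qed.

Lemma code_dist_continuous t : continuous (code_dist t).
Proof.
elim: t => [|x t IH].
  have -> : code_dist [::] = fun=> 0.
    by apply/funext => y; rewrite /code_dist big_nil.
  by move=> y; exact: cvg_cst.
have -> : code_dist (x :: t) =
    fun y => `|x.1.2| * `|f x.1.1 y - x.2| + code_dist t y.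
  by apply/funext => y; rewrite /code_dist big_cons.
move=> y; apply: cvgD; last exact: IH.
apply: cvgMr; apply: cvg_norm; apply: cvgB; last exact: cvg_cst.
exact: CK_continuous.
Qed.

(** The positive part of [1 - code_dist t]: it is 1 where [code_dist t] vanishes and 0 where it is
    at least 1. *)
Definition bump_fun t y := (1 - code_dist t y + `|1 - code_dist t y|) / 2.

Lemma bump_fun_continuous t : continuous (bump_fun t).
Proof.
move=> y; have h : 1 - code_dist t z @[z --> y] --> 1 - code_dist t y.
  by apply: cvgB; [exact: cvg_cst|exact: code_dist_continuous].
by apply: cvgMl; apply: cvgD => //; exact: cvg_norm.
Qed.

Definition bump t : CK R cK :=
  @SupFun R K (continuous_space R cK) (bump_fun t)
    (mem_set (@bump_fun_continuous t)).

Lemma bumpE t y : bump t y = (1 - code_dist t y + `|1 - code_dist t y|) / 2.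
Proof. by []. Qed.

Lemma class_invariant_bump t : class_invariant (bump t).
Proof. by move=> y p yp; rewrite !bumpE (code_dist_eqv _ yp). Qed.

Lemma class_invariant_sum (I : Type) (s : seq I) (a : I -> R)
    (u : I -> CK R cK) :
  (forall i, class_invariant (u i)) ->
  class_invariant (\sum_(i <- s) a i *: u i).
Proof.
move=> uA y p yp; rewrite !CK_sumE.
by apply: eq_bigr => i _; rewrite (uA _ _ _ yp).
Qed.

Section Level.
Context (n : nat).

Definition isolated_class := [set p | cb_derivative K n p /\
  forall y, eqv y p -> ~ cb_derivative K n.+1 y].

Lemma isolated_class_eqv y p :
  cb_derivative K n y -> eqv y p -> isolated_class p -> isolated_class y.
Proof.
by move=> ny yp [_ Pp]; split=> // z zy; apply: Pp; exact: eqv_trans yp.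
Qed.

Definition separating p := [set t | code_dist t p = 0 /\
  forall y, cb_derivative K n y -> ~ eqv y p -> 1 <= code_dist t y].

(** Finitely many terms suffice by compactness, codes being combined by concatenation. Near a point
    equivalent to [p] nothing needs separating, as it is isolated in the derivative or outside
    it. *)
Lemma separating_ex p : isolated_class p -> exists t, separating p t.
Proof.
move=> [np Pp].
suff [t [tp tT]] : exists t, code_dist t p = 0 /\ forall y, [set: K] y ->
    cb_derivative K n y -> ~ eqv y p -> 1 <= code_dist t y.
  by exists t; split=> // y; exact: tT.
apply: (@compact_ind K (fun U => exists t, code_dist t p = 0 /\ forall y, U y ->
    cb_derivative K n y -> ~ eqv y p -> 1 <= code_dist t y) cK).
- by exists [::]; split=> //; rewrite /code_dist big_nil.
- by move=> C D CD [t [tp tD]]; exists t; split=> // y /CD; exact: tD.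
- move=> C D [s [sp sC]] [t [tp tD]]; exists (s ++ t).
  have htc y : code_dist (s ++ t) y = code_dist s y + code_dist t y.
    exact: big_cat.
  split; first by rewrite htc sp tp addr0.
  move=> y [Cy|Dy] ny yp; rewrite htc.
    by have := sC _ Cy ny yp; have := code_dist_ge0 t y; lra.
  by have := tD _ Dy ny yp; have := code_dist_ge0 s y; lra.
move=> z; have [zp|/existsNP[b zb]] := pselect (eqv z p); last first.
  pose d := `|f b z - f b p|.
  have d0 : 0 < d by rewrite normr_gt0 subr_eq0; apply/eqP.
  (* The weight [2 / d] brings the term up to 1 wherever [f b] differs from its value at [z] by less
     than [d / 2]. *)
  have htb y : code_dist [:: (b, 2 / d, f b p)] y = 2 / d * `|f b y - f b p|.
    by rewrite /code_dist big_seq1 /= ger0_norm// divr_ge0// ltW.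
  exists [set y | `|f b z - f b y| < d / 2].
    by have /cvgrPdist_lt := @CK_continuous (f b) z; apply; rewrite divr_gt0.
  exists [:: (b, 2 / d, f b p)]; split; first by rewrite htb subrr normr0 mulr0.
  move=> y /= zy _ _; rewrite htb -ler_pdivrMl ?divr_gt0// invf_div mulr1.
  have := ler_normD (f b z - f b y) (f b y - f b p).
  by rewrite addrA subrK -/d; lra.
have [nz|nnz] := pselect (cb_derivative K n z); last first.
  exists (~` cb_derivative K n).
    exact: closed_nbhsC (@closed_cb_derivative K n) nnz.
  by exists [::]; split=> [|y //]; rewrite /code_dist big_nil.
have [_ [V zV Vn]] : isolated (cb_derivative K n) z.
  by apply: contrapT => iz; apply: (Pp z zp); split.
exists V => //; exists [::]; split=> [|y Vy ny yp].
  by rewrite /code_dist big_nil.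
suff yz : [set z] y by case: yp; rewrite yz.
by rewrite -Vn.
Qed.

(** Choosing from a set that depends only on the class of [p] gives equivalent points the same
    code. *)
Definition class_code p : code := xget [::] (separating p).

Lemma class_code_separating p : isolated_class p -> separating p (class_code p).
Proof. by move=> /separating_ex; exact: xgetPex. Qed.

Lemma class_code_eqv y p : eqv y p -> class_code y = class_code p.
Proof.
move=> yp; congr xget; apply/seteqP; split=> t [tp tn].
  split=> [|z nz zp]; first by rewrite -(code_dist_eqv t yp).
  by apply: tn => // zy; apply: zp; exact: eqv_trans yp.
split=> [|z nz zp]; first by rewrite (code_dist_eqv t yp).
by apply: tn => // zy; apply: zp; exact: eqv_trans (eqv_sym yp).
Qed.

(** This is the indicator of the class of [p], since distinct isolated classes have distinct
    codes. *)
Lemma bump_class_code p y : isolated_class p -> cb_derivative K n y ->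
  bump (class_code p) y =
    (`[< isolated_class y >] && (class_code p == class_code y))%:R.
Proof.
move=> Pp ny; have [tp tn] := class_code_separating Pp; rewrite bumpE.
have [yp|yp] := pselect (eqv y p).
  rewrite (code_dist_eqv _ yp) tp (class_code_eqv yp) eqxx andbT.
  rewrite asboolT; last exact: isolated_class_eqv yp Pp.
  by rewrite subr0 normr1 divff.
have ge1 := tn _ ny yp; rewrite ler0_norm ?subrr ?mul0r; last by lra.
case: asboolP => //= Py; case: eqP => // e.
have [ty _] := class_code_separating Py.
by move: ge1; rewrite e ty ler10.
Qed.

Definition class_codes := class_code @` isolated_class.

Lemma sum_bump (s : seq code) (a : code -> R) y :
  uniq s -> (forall t, t \in s -> class_codes t) -> cb_derivative K n y ->
  (\sum_(t <- s) a t *: bump t) y =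
    (`[< isolated_class y >] && (class_code y \in s))%:R * a (class_code y).
Proof.
move=> us sT ny; rewrite CK_sumE.
rewrite (eq_big_seq (fun t =>
    a t * (`[< isolated_class y >] && (t == class_code y))%:R)); last first.
  by move=> t /sT[p Pp <-]; rewrite bump_class_code.
case: asboolP => Py /=; last by rewrite big1 ?mul0r// => t _; rewrite mulr0.
have [ys|ys] := boolP (class_code y \in s).
  rewrite (bigD1_seq (class_code y))//= eqxx mulr1 mul1r big1 ?addr0//.
  by move=> t /negbTE ->; rewrite mulr0.
rewrite mul0r big_seq big1// => t ts; case: eqP => [e|]; last by rewrite mulr0.
by move: ys; rewrite -e ts.
Qed.

(* Subtracting finitely many bumps makes g small on the n-th derivative without
   changing phi g. *)
Lemma level_bounded_succ phi : level_bounded n phi ->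
  (forall t, class_codes t -> phi (bump t) = 0) -> level_bounded n.+1 phi.
Proof.
move=> [lphi [c phic]] phiT; split=> //; exists `|c| => g gA M M0 gM.
suff H e : 0 < e -> `|phi g| <= `|c| * (M + e).
  have c1 : 0 < `|c| + 1 by rewrite ltr_wpDl.
  apply/ler_addgt0Pr => e e0; apply: (le_trans (H (e / (`|c| + 1)) _)).
    by rewrite divr_gt0.
  rewrite mulrDr lerD2l mulrCA ler_piMr ?(ltW e0)//.
  by rewrite ler_pdivrMr// mul1r lerDl.
(* The slack [e] makes [E] finite: near a point of the next derivative [|g|] stays below [M + e],
   and the other points of the n-th derivative are isolated. *)
move=> e0; pose E := [set p | isolated_class p /\ M + e <= `|g p|].
have finE : finite_set E.
  apply: (@sub_finite_set _ _
      ([set: K] `&` [set p | cb_derivative K n p /\ M + e <= `|g p|])).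
    by move=> p [[]].
  apply: (@compact_ind K (fun U => finite_set (U `&` _)) cK).
  - by rewrite set0I.
  - by move=> C D CD; apply: sub_finite_set; exact: setSI.
  - by move=> C D fC fD; rewrite setIUl finite_setU.
  move=> z; have [nz|nnz] := pselect (cb_derivative K n z); last first.
    exists (~` cb_derivative K n).
      exact: closed_nbhsC (@closed_cb_derivative K n) nnz.
    by rewrite (_ : _ `&` _ = set0)// -subset0 => y [nny []].
  have [[_ [V zV Vn]]|iz] := pselect (isolated (cb_derivative K n) z).
    exists V => //; apply: sub_finite_set (finite_set1 z).
    by rewrite -Vn => y [Vy []].
  have gz : `|g z| <= M by apply: gM; split.
  exists [set y | `|g z - g y| < e].
    by have /cvgrPdist_lt := @CK_continuous g z; apply.
  rewrite (_ : _ `&` _ = set0)// -subset0 => y [/= gzy [_ gy]].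
  by have := ler_normB (g z) (g z - g y); rewrite opprB addrC subrK; lra.
pose S := fset_set (class_code @` E).
have finS : finite_set (class_code @` E) by exact: finite_image.
have ST t : (t \in S) -> exists2 p, E p & class_code p = t.
  by rewrite in_fset_set// => /set_mem[p]; exists p.
have aP t : exists r, t \in S -> exists p, [/\ E p, class_code p = t & g p = r].
  have [/ST[p Ep <-]|_] := boolP (t \in S); last by exists 0.
  by exists (g p) => _; exists p.
pose a t := projT1 (cid (aP t)).
have aS t : t \in S -> exists p, [/\ E p, class_code p = t & g p = a t].
  exact: projT2 (cid (aP t)).
pose h : CK R cK := \sum_(t <- S) a t *: bump t.
have -> : phi g = phi (-1 *: h + g).
  rewrite lphi functional_sum// big_seq big1 ?mulr0 ?add0r//.
  by move=> t /ST[p [Pp _] <-]; rewrite phiT ?mulr0//; exists p.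
rewrite (le_trans (phic _ _ (M + e) _ _))//.
- move=> y p yp; rewrite !supFunDE !supFunZE (gA _ _ yp); congr (_ * _ + _).
  exact: (class_invariant_sum _ _ class_invariant_bump).
- by rewrite addr_ge0// ltW.
- move=> y ny; have ST' t : t \in S -> class_codes t.
    by move=> /ST[p [Pp _] <-]; exists p.
  rewrite supFunDE supFunZE (sum_bump a (fset_uniq S) ST' ny).
  have [Py|Py] := pselect (isolated_class y); last first.
    rewrite asboolF//= mul0r mulr0 add0r.
    (* A class that is not isolated reaches the next derivative, where the bound [M] on the
       invariant [g] applies. *)
    have [z [zy nz]] : exists z, eqv z y /\ cb_derivative K n.+1 z.
      apply: contrapT => /forallNP H; apply: Py; split=> // z zy nz.
      by apply: (H z).
    by rewrite -(gA _ _ zy) (le_trans (gM _ nz))// lerDl ltW.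
  rewrite asboolT//=; have [yS|yS] := boolP (class_code y \in S).
    have [p [[Pp _] py <-]] := aS _ yS.
    have gpy : g p = g y.
      apply: gA; apply: contrapT => npy; have [np _] := Pp.
      have [tp tn] := class_code_separating Py; have := tn _ np npy.
      by rewrite -py; have [-> _] := class_code_separating Pp; rewrite ler10.
    by rewrite gpy mul1r mulN1r addNr normr0 addr_ge0// ltW.
  rewrite mul0r mulr0 add0r leNgt; apply/negP => /ltW gy.
  by move: yS => /negP; apply; rewrite in_fset_set// inE; exists y.
by rewrite ler_wpM2r ?ler_norm// addr_ge0// ltW.
Qed.

(** Bumps with distinct codes are indicators of disjoint classes, so their signed sums are bounded
    by 1 on the derivative. Finite sums of [|phi (bump t)|] are therefore at most [c], and only
    finitely many terms reach a given [m.+1%:R^-1]. *)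
Lemma countable_support phi : level_bounded n phi ->
  countable [set t | class_codes t /\ phi (bump t) != 0].
Proof.
move=> [lphi [c phic]].
pose S m := [set t | class_codes t /\ m.+1%:R^-1 <= `|phi (bump t)|].
apply: (@sub_countable _ _ _ (\bigcup_(m in [set: nat]) S m)).
  apply: subset_card_le => t [Tt]; rewrite -normr_gt0 => t0.
  exists (Num.truncn `|phi (bump t)|^-1) => //; split=> //.
  rewrite -[leRHS]invrK lef_pV2 ?posrE ?invr_gt0//.
  by rewrite ltW// truncnS_gt.
apply: bigcup_countable => // m _; apply: finite_set_countable.
apply: contrapT => /infinite_set_fset infS.
pose N := (Num.truncn (c * m.+1%:R)).+1.
have [F FS NF] := infS N.
have FT t : t \in F -> class_codes t by move=> /FS[].
pose h : CK R cK := \sum_(t <- F) Num.sg (phi (bump t)) *: bump t.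
have : `|phi h| <= c * 1.
  apply: phic => //.
    exact: (class_invariant_sum _ _ class_invariant_bump).
  move=> y ny; rewrite (sum_bump _ (fset_uniq F) FT ny) normrM normr_nat.
  case: (_ && _); last by rewrite mul0r.
  by rewrite mul1r normr_sg; case: (_ != _).
rewrite functional_sum// mulr1 leNgt => /negP; apply.
under eq_bigr do rewrite -normrEsg.
rewrite ger0_norm ?sumr_ge0//.
apply: (@lt_le_trans _ _ (\sum_(t <- F) m.+1%:R^-1)); last first.
  by rewrite big_seq [leRHS]big_seq; apply: ler_sum => t /FS[].
rewrite big_const_seq count_predT iter_addr_0 -[ltRHS]mulr_natl.
rewrite ltr_pdivlMr ?ltr0n//.
by rewrite (lt_le_trans (truncnS_gt _))// ler_nat.
Qed.

(* phi and psi with the same values on the bumps of level n differ by a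
   functional living on the next level, so phi is determined by a countable set
   of data and by its difference to a reference functional with these data. *)
Lemma level_step (cB : codable B) :
  (exists c : (CK R cK -> R) -> (nat -> bool), forall phi psi,
    level_bounded n.+1 phi -> level_bounded n.+1 psi -> c phi = c psi ->
    forall b, phi (f b) = psi (f b)) ->
  exists c : (CK R cK -> R) -> (nat -> bool), forall phi psi,
    level_bounded n phi -> level_bounded n psi -> c phi = c psi ->
    forall b, phi (f b) = psi (f b).
Proof.
move=> [c' c'P].
have cU : codable (code * R).
  apply: codable_prod (codable_real R); apply: codable_seq.
  by apply: codable_prod (codable_real R); apply: codable_prod (codable_real R).
have [enc encP] := codable_countable_subsets cU.
pose D phi := (fun t => (t, phi (bump t))) @`
  [set t | class_codes t /\ phi (bump t) != 0].
have cD phi : level_bounded n phi -> countable (D phi).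
  move=> /countable_support; apply: card_le_trans; exact: card_image_le.
have DE phi psi : D phi = D psi ->
    forall t, class_codes t -> phi (bump t) = psi (bump t).
  have H phi' psi' t : D phi' = D psi' -> class_codes t -> phi' (bump t) != 0 ->
      phi' (bump t) = psi' (bump t).
    move=> e Tt t0; have : D phi' (t, phi' (bump t)) by exists t.
    by rewrite e => -[s _ [st <-]]; rewrite st.
  move=> e t Tt; have [p0|] := eqVneq (phi (bump t)) 0; last exact: H.
  have [-> //|q0] := eqVneq (psi (bump t)) 0.
  by apply/esym/H.
pose Q e := [set psi | level_bounded n psi /\ enc (D psi) = e].
pose ref e := xget (fun=> 0) (Q e).
have refP phi : level_bounded n phi ->
    level_bounded n (ref (enc (D phi))) /\ D (ref (enc (D phi))) = D phi.
  move=> Hphi.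
  have /(xgetPex (fun=> 0))[Hr e] : exists psi, Q (enc (D phi)) psi.
    by exists phi.
  by split=> //; apply: encP => //; exact: cD.
have refB phi : level_bounded n phi ->
    level_bounded n.+1 (fun g => phi g - ref (enc (D phi)) g).
  move=> Hphi; have [Hr Dr] := refP _ Hphi.
  apply: level_bounded_succ; last first.
    by move=> t Tt; rewrite (DE _ _ Dr)// subrr.
  have [lphi [c phic]] := Hphi; have [lr [d rd]] := Hr; split.
    by move=> a u v; rewrite lphi lr; lra.
  exists (c + d) => g gA M M0 gM; rewrite mulrDl (le_trans (ler_normB _ _))//.
  by rewrite lerD ?phic ?rd.
have [pr prI] := codable_prod codable_cantor codable_cantor.
exists (fun phi => pr (enc (D phi), c' (fun g => phi g - ref (enc (D phi)) g))).
move=> phi psi Hphi Hpsi /prI[e] e' b.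
have := c'P _ _ (refB _ Hphi) (refB _ Hpsi) e' b; rewrite e.
exact: addIr.
Qed.

End Level.

(** Descending induction on the level. At level [n] the derivative is empty, so the bound with
    [M = 0] makes every functional vanish on the [f b]. *)
Lemma functionals_codable (n : nat) : codable B -> cb_derivative K n = set0 ->
  exists c : (CK R cK -> R) -> (nat -> bool), forall phi psi,
    level_bounded 0 phi -> level_bounded 0 psi -> c phi = c psi ->
    forall b, phi (f b) = psi (f b).
Proof.
move=> cB Kn; suff : forall k i, (i + k)%N = n ->
    exists c : (CK R cK -> R) -> (nat -> bool), forall phi psi,
    level_bounded i phi -> level_bounded i psi -> c phi = c psi ->
    forall b, phi (f b) = psi (f b) by move=> /(_ n 0%N (add0n n)).
elim=> [i|k IH i].
  rewrite addn0 => ->; exists (fun _ _ => true).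
  suff z phi b : level_bounded n phi -> phi (f b) = 0.
    by move=> phi psi Hphi Hpsi _ b; rewrite !z.
  move=> [_ [c phic]]; apply/normr0_eq0/eqP; rewrite -normr_le0.
  rewrite normr_id -(mulr0 c); by apply: phic => // y; rewrite Kn.
by rewrite addnS -addSn => /IH; exact: level_step.
Qed.

End CountingFunctionals.

(** * The twisted sum attached to an almost disjoint family *)

Lemma subr_subACA (V : zmodType) (a b c d : V) :
  a - b - (c - d) = a - c - (b - d).
Proof. by rewrite !opprB addrACA [RHS]addrACA [- b - c]addrC. Qed.

Lemma linear_contraction_continuous (R : numFieldType) (V W : normedModType R)
    (l : {linear V -> W}) : (forall v, `|l v| <= `|v|) -> continuous l.
Proof.
move=> lc; apply/linear_bounded_continuous/bounded_funP => r.
by exists r => v; exact: le_trans.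
Qed.

Section AlmostDisjointExtension.
Context (R : realType) (K : topologicalType) (cK : compact [set: K]).
Context (B : choiceType) (A : B -> set nat) (e : B -> K) (x : K).
Hypothesis A_ad : forall b b', b <> b' ->
  exists N, forall n, (N <= n)%N -> A b n -> ~ A b' n.
Hypothesis e_cvg : forall g : K -> R, continuous g -> forall eps, 0 < eps ->
  finite_set [set b | eps <= `|g (e b) - g x|].

(* The traces on nat of the neighbourhoods of e b (o = Some b) and of x
   (o = None) in the space obtained by adding nat to the points e b and x, each
   A b converging to e b. *)
Definition ad_filter (o : option B) : set_system nat :=
  [set S | exists (J : seq B) (N : nat), forall n, (N <= n)%N ->
    (if o is Some b then A b n else forall b, b \in J -> ~ A b n) -> S n].

Definition ad_point (o : option B) : K := if o is Some b then e b else x.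

#[global] Instance ad_filter_filter o : Filter (ad_filter o).
Proof.
split.
- by exists [::], 0%N.
- move=> S T [J [M SM]] [L [N TN]]; exists (J ++ L), (maxn M N) => n.
  rewrite geq_max => /andP[Mn Nn] on; split; [apply: SM|apply: TN] => //.
    by case: o on {TN} => //= on b bJ; apply: on; rewrite mem_cat bJ.
  by case: o on {SM} => //= on b bL; apply: on; rewrite mem_cat bL orbT.
- by move=> S T ST [J [N SN]]; exists J, N => n Nn on; exact/ST/SN.
Qed.

Lemma ad_filter_oo o : ad_filter o --> \oo.
Proof. by move=> S [N _ NS]; exists [::], N => n /NS. Qed.

(** The filter at [x] accounts for all large [n] outside finitely many sets [A b], and the filters
    at the corresponding [e b] account for those sets. *)
Lemma ad_filter_near (S : set nat) : (forall o, ad_filter o S) -> \oo S.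
Proof.
move=> oS; have [J [N NS]] := oS None.
have [M MS] : exists M, forall n, (M <= n)%N ->
    forall b, b \in J -> A b n -> S n.
  elim: J {NS} => [|b J [M MS]]; first by exists 0%N.
  have [_ [L LS]] := oS (Some b); exists (maxn M L) => n.
  rewrite geq_max => /andP[Mn Ln] b'; rewrite in_cons => /orP[/eqP ->|].
    exact: LS.
  exact: MS.
exists (maxn M N) => // n /=; rewrite geq_max => /andP[Mn Nn].
apply: contrapT => nSn; apply: (nSn); apply: NS => // b bJ Abn.
by apply: nSn; exact: MS bJ Abn.
Qed.

(** The pullback made concrete: a bounded sequence together with a function in C(K) that prescribes
    its limits along the [A b] and away from them. *)
Definition ad_functions : set (nat + K -> R) := [set h : nat + K -> R |
  [/\ continuous (h \o inr), exists M, forall n, `|h (inl n)| <= M &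
      forall o, (h \o inl) @ ad_filter o --> h (inr (ad_point o))]].

Lemma ad_functions0 : ad_functions 0.
Proof.
split=> [|| o]; [by move=> y; exact: cvg_cst| |exact: cvg_cst].
by exists 0 => n; rewrite normr0.
Qed.

Lemma ad_functionsD h k :
  ad_functions h -> ad_functions k -> ad_functions (h + k).
Proof.
move=> [ch [M hM] fh] [ck [N kN] fk]; split=> [y||o].
- by apply: cvgD; [exact: ch|exact: ck].
- by exists (M + N) => n; rewrite (le_trans (ler_normD _ _))// lerD.
- by apply: cvgD; [exact: fh|exact: fk].
Qed.

Lemma ad_functionsZ (a : R) h : ad_functions h -> ad_functions (a *: h).
Proof.
move=> [ch [M hM] fh]; split=> [y||o].
- by apply: cvgZr; exact: ch.
- by exists (`|a| * M) => n; rewrite normrM ler_wpM2l.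
- by apply: cvgZr; exact: fh.
Qed.

Lemma ad_functions_bounded h :
  ad_functions h -> exists M, forall s, `|h s| <= M.
Proof.
move=> [ch [M hM] _]; have [N hN] := continuous_functions_bounded cK ch.
exists (Num.max M N) => -[n|y]; rewrite le_max; first by rewrite hM.
by rewrite (hN y) orbT.
Qed.

Lemma ad_functions_closed h :
  (forall eps, 0 < eps ->
    exists2 k, ad_functions k & forall s, `|h s - k s| <= eps) ->
  ad_functions h.
Proof.
move=> H; split=> [||o].
- apply: continuous_functions_closed => eps /H[k [ck _ _] hk].
  by exists (k \o inr) => // y; exact: hk.
- have [k [_ [M kM] _] hk] := H 1 ltr01; exists (1 + M) => n.
  by rewrite -[h _](subrK (k (inl n))) (le_trans (ler_normD _ _))// lerD.
- apply: uniform_dist_lt => eps /H[k [_ _ fk] hk].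
  exists (k \o inl), (k (inr (ad_point o))).
  by split=> [||n]; [exact: fk|exact: hk|exact: hk].
Qed.

Definition ad_space : supNormSpace R (nat + K) :=
  SupNormSpace ad_functions0 ad_functionsD ad_functionsZ ad_functions_bounded
    ad_functions_closed.

Let Z : completeNormedModType R := supFun ad_space.

Lemma ad_in_subproof (u : c0 R) :
  ad_functions (fun s => if s is inl n then u n else 0).
Proof.
have u0 := supFunP u; split=> [||o].
- by move=> y; exact: cvg_cst.
- exact: null_sequences_bounded u0.
- exact: cvg_comp (ad_filter_oo o) u0.
Qed.

Definition ad_in (u : c0 R) : Z :=
  @SupFun R _ ad_space _ (mem_set (ad_in_subproof u)).

Lemma ad_in_is_linear : linear ad_in.
Proof.
move=> a u v; apply/val_inj/funext => -[n //|y].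
have a0 : a * 0 + 0 = 0 :> R by rewrite mulr0 addr0.
exact: esym a0.
Qed.
HB.instance Definition _ :=
  GRing.isLinear.Build R (c0 R) Z *:%R ad_in ad_in_is_linear.

Lemma ad_out_subproof (h : Z) : continuous ((h : nat + K -> R) \o inr).
Proof. by have [] := supFunP h. Qed.

Definition ad_out (h : Z) : CK R cK :=
  @SupFun R K (continuous_space R cK) _ (mem_set (@ad_out_subproof h)).

Lemma ad_out_is_linear : linear ad_out.
Proof. by move=> a u v; apply/val_inj/funext. Qed.
HB.instance Definition _ :=
  GRing.isLinear.Build R Z (CK R cK) *:%R ad_out ad_out_is_linear.

Lemma ad_in_continuous : continuous ad_in.
Proof.
apply: linear_contraction_continuous => u.
by apply: supnorm_le => // -[n|y] /=; rewrite ?normr0//; exact: le_supnorm.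
Qed.

Lemma ad_out_continuous : continuous ad_out.
Proof.
apply: linear_contraction_continuous => h.
by apply: supnorm_le => // y; exact: (le_supnorm h).
Qed.

Lemma ad_in_inj : injective ad_in.
Proof.
move=> u v /(congr1 val) uv; apply/val_inj/funext => n.
exact: (congr1 (@^~ (inl n)) uv).
Qed.

Lemma ad_exact : range ad_in = ad_out @^-1` [set 0].
Proof.
apply/seteqP; split=> [_ [u _ <-]|h /= /(congr1 val) h0].
  by apply/val_inj/funext.
have hr y : h (inr y) = 0 by exact: (congr1 (@^~ y) h0).
have hu : null_sequences ((h : nat + K -> R) \o inl).
  apply/cvgrPdist_lt => eps eps0; apply: ad_filter_near => o.
  have [_ _ /(_ o)/cvgrPdist_lt/(_ _ eps0)] := supFunP h.
  by rewrite hr.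
exists (@SupFun R _ (null_sequence_space R) _ (mem_set hu)) => //.
by apply/val_inj/funext => -[n|y] //=; rewrite hr.
Qed.

Lemma ad_seq b (J : seq B) : exists N, forall n, (N <= n)%N -> A b n ->
  forall b', b' \in J -> A b' n -> b' = b.
Proof.
elim: J => [|c J [N NJ]]; first by exists 0%N.
have [M MJ] : exists M, forall n, (M <= n)%N -> A b n -> A c n -> c = b.
  have [->|/eqP bc] := eqVneq b c; first by exists 0%N.
  by have [M MA] := A_ad bc; exists M => n Mn Abn /(MA n Mn Abn).
exists (maxn M N) => n; rewrite geq_max => /andP[Mn Nn] Abn b'.
by rewrite in_cons => /orP[/eqP ->|]; [exact: MJ|exact: NJ].
Qed.

(* At n, the lift takes the value of g at a point e b with n in A b for which
   |g (e b) - g x| is maximal up to a factor 2. *)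
Lemma ad_lift (g : CK R cK) : exists2 h : Z, ad_out h = g & `|h| <= `|g|.
Proof.
pose d b := `|g (e b) - g x|.
have cg : continuous (g : K -> R) by exact: (supFunP g).
have d_le b : d b <= `|g| + `|g|.
  by rewrite (le_trans (ler_normB _ _))// lerD ?le_supnorm.
pose best n (o : option B) := if o is Some b
  then A b n /\ forall b', A b' n -> d b' <= 2 * d b else forall b, ~ A b n.
have /choice[w wP] : forall n, exists o, best n o.
  move=> n.
  have [[b Abn]|/forallNP] := pselect (exists b, A b n); last by exists None.
  pose D := [set d b | b in [set b | A b n]].
  have D0 : D !=set0 by exists (d b), b.
  have Dub : has_ubound D by exists (`|g| + `|g|) => _ [c _ <-].
  have dD c : A c n -> d c <= sup D.
    by move=> Ac; apply: ub_le_sup => //; exists c.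
  have [D_gt0|D_le0] := ltP 0 (sup D); last first.
    exists (Some b); split=> // c /dD dc.
    rewrite (le_trans dc)// (le_trans D_le0)//.
    exact: mulr_ge0 (ler0n R 2) (normr_ge0 _).
  have [|_ [c /= Acn <-] dc] := @sup_adherent _ D (sup D / 2) _ (conj D0 Dub).
    by rewrite divr_gt0.
  by exists (Some c); split=> // c' /dD; lra.
pose h (s : nat + K) :=
  match s with inl n => g (ad_point (w n)) | inr y => g y end.
have h_le s : `|h s| <= `|g| by case: s => [n|y]; exact: le_supnorm.
have hZ : ad_functions h.
  split=> [||p]; [exact: cg|by exists `|g| => n; exact: (h_le (inl n))|].
  apply/cvgrPdist_lt => eps eps0.
  (* At [n] in [A b] the lift uses some [c] with [d b <= 2 * d c], so the error is at most
     [d b + d c <= 3 * d c], below [eps] when [c] is outside [J]. *)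
  have /finite_seqP[J JE] := e_cvg cg (divr_gt0 eps0 (ltr0n R 3)).
  have dJ b : b \notin J -> d b < eps / 3.
    move=> /negP bJ; rewrite ltNge; apply/negP => db; apply: bJ.
    by suff : [set` J] b by []; rewrite -JE.
  case: p => [b|]; last first.
    exists J, 0%N => n _ nJ /=; have := wP n; case: (w n) => [b [Abn _]|_] /=.
      have bJ : b \notin J by apply/negP => /nJ.
      by rewrite distrC; have := dJ b bJ; rewrite /d; lra.
    by rewrite subrr normr0.
  have [N NJ] := ad_seq b J; exists [::], N => n Nn /= Abn.
  have := wP n; case: (w n) => [c [Acn cd]|/(_ b)//] /=.
  have [-> |/eqP bc] := eqVneq b c; first by rewrite subrr normr0.
  have cJ : c \notin J by apply/negP => cJ; apply/bc/esym/(NJ n).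
  have := dJ c cJ; have := cd b Abn.
  have := ler_normB (g (e b) - g x) (g (e c) - g x).
  rewrite opprB addrA subrK /d; lra.
exists (@SupFun R _ ad_space _ (mem_set hZ)); first by apply/val_inj.
by apply: supnorm_le => // s; exact: h_le.
Qed.

Lemma ad_out_surj : range ad_out = [set: CK R cK].
Proof.
by apply/seteqP; split=> // g _; have [h <-] := ad_lift g; exists h.
Qed.

Definition ad_twisted_sum : twisted_sum (c0 R) (CK R cK) :=
  @TwistedSum R (c0 R) (CK R cK) Z ad_in ad_out ad_in_continuous
    ad_out_continuous ad_in_inj ad_exact ad_out_surj.

(** For a projection [P] onto the copy of c_0, [Q h = h - P h] kills that copy, so [Q (l g)] is
    linear in [g] whichever lift [l] is chosen; [phi n] is its n-th coordinate. *)
Lemma ad_trivial : ts_trivial ad_twisted_sum ->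
  exists phi : nat -> CK R cK -> R,
    [/\ forall n, is_functional (phi n),
        exists c, forall n g, `|phi n g| <= c * `|g| &
        forall g o, (fun n => phi n g) @ ad_filter o --> g (ad_point o)].
Proof.
move=> [P [Pc PP rP]]; rewrite /= in P Pc PP rP.
pose Q (h : Z) : Z := h - P h.
have kerQ h : ad_out h = 0 -> Q h = 0.
  move=> h0; have : (ad_out @^-1` [set 0]) h by [].
  by rewrite -ad_exact -rP => -[k _ <-]; rewrite /Q PP subrr.
have QB h k : ad_out h = ad_out k -> Q h = Q k.
  move=> hk; apply/eqP; rewrite -subr_eq0; apply/eqP.
  rewrite -(kerQ (h - k)); last by rewrite linearB /= hk subrr.
  by rewrite /Q (linearB P); exact: subr_subACA.
have oQ h : ad_out (Q h) = ad_out h.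
  rewrite linearB /=; suff -> : ad_out (P h) = 0 by rewrite subr0.
  have : range P (P h) by exists h.
  by rewrite rP ad_exact.
have [c cP] : exists c, forall h, `|P h| <= c * `|h|.
  have /linear_boundedP/pinfty_ex_gt0[c _ cP] : bounded_near P (nbhs (0 : Z)).
    exact/linear_bounded_continuous.
  by exists c.
pose l g := projT1 (cid2 (ad_lift g)).
have lout g : ad_out (l g) = g by rewrite /l; case: cid2.
have l_le g : `|l g| <= `|g| by rewrite /l; case: cid2.
exists (fun n g => Q (l g) (inl n)); split.
- move=> n a u v; rewrite (QB _ (a *: l u + l v)); last first.
    by rewrite linearP /= !lout.
  have -> : Q (a *: l u + l v) = a *: Q (l u) + Q (l v).
    by rewrite /Q linearP scalerBr opprD addrACA.
  by [].
- exists (1 + `|c|) => n g; apply: le_trans (le_supnorm (Q (l g)) (inl n)) _.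
  have Qle : `|Q (l g)| <= `|l g| + `|P (l g)| by exact: ler_normB.
  apply: (le_trans Qle); rewrite mulrDl mul1r lerD ?l_le//.
  rewrite (le_trans (cP _))// (le_trans (ler_wpM2r _ (ler_norm c)))//.
  by rewrite ler_wpM2l.
- move=> g o; have [_ _ /(_ o)] := supFunP (Q (l g)).
  suff -> : Q (l g) (inr (ad_point o)) = g (ad_point o) by [].
  by rewrite -[in RHS](lout g) -oQ.
Qed.

End AlmostDisjointExtension.

(** * Diagonalization *)

(** A branch of the full binary tree, with nodes numbered by [choice.pickle]; two branches share
    only the nodes up to their splitting point. *)
Definition branch (b : nat -> bool) : set nat :=
  [set n : nat | exists k, n = choice.pickle (mkseq b k)].

Lemma branch_infinite b N : exists2 n, (N <= n)%N & branch b n.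
Proof.
have inj : injective (fun k => choice.pickle (mkseq b k)).
  by move=> k l /(pcan_inj choice.pickleK)/(congr1 size); rewrite !size_mkseq.
have [k Nk] := injective_gtn inj N.
by exists (choice.pickle (mkseq b k)); [exact: ltnW|exists k].
Qed.

Lemma branch_ad b b' : b <> b' ->
  exists N, forall n, (N <= n)%N -> branch b n -> ~ branch b' n.
Proof.
move=> bb'; have /existsNP[m bm] : ~ forall m, b m = b' m.
  by move=> H; apply/bb'/funext.
(* Beyond this bound every node of [b] has length greater than [m], so it records the disagreement
   at [m]. *)
exists (\max_(k < m.+1) choice.pickle (mkseq b k)).+1 => n Nn [k nk] [k'].
rewrite nk => /(pcan_inj choice.pickleK) e.
have kk' : k = k' by rewrite -(size_mkseq b k) e size_mkseq.
have [km|mk] := leqP k m; last first.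
  by apply: bm; rewrite -(nth_mkseq false b mk) e nth_mkseq// -kk'.
have := @leq_bigmax _ (fun i : 'I_m.+1 => choice.pickle (mkseq b i))
  (Ordinal (km : (k < m.+1)%N)).
by rewrite /= -nk leqNgt Nn.
Qed.

Definition cantor_cons (c : bool) (b : nat -> bool) (n : nat) : bool :=
  if n is m.+1 then b m else c.

Lemma cantor_cons_inj c b c' b' :
  cantor_cons c b = cantor_cons c' b' -> c = c' /\ b = b'.
Proof.
move=> e; split; first exact: (congr1 (fun h : nat -> bool => h 0%N) e).
by apply/funext => m; exact: (congr1 (fun h : nat -> bool => h m.+1) e).
Qed.

(** Two almost disjoint infinite sets cannot both agree with [S] up to finitely many elements. *)
Lemma branch_avoid b (S : set nat) : exists c, ~ exists N, forall n,
  (N <= n)%N -> S n <-> branch (cantor_cons c b) n.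
Proof.
apply: contrapT => /forallNP H.
have [N NP] := contrapT (H true); have [M MP] := contrapT (H false).
have [L LP] : exists L, forall n, (L <= n)%N ->
    branch (cantor_cons true b) n -> ~ branch (cantor_cons false b) n.
  by apply: branch_ad => /cantor_cons_inj[].
have [n] := branch_infinite (cantor_cons true b) (maxn N (maxn M L)).
rewrite !geq_max => /and3P[Nn Mn Ln] bn.
by apply: (LP n Ln bn); apply/MP => //; apply/NP.
Qed.

Theorem theorem3p5 (R : realType) (K : topologicalType)
    (cK : compact [set: K]) :
  martin_axiom R -> ~ continuum_hypothesis R ->
  hausdorff_space K -> scattered_finite_height K -> weight_ge K [set: R] ->
  exists E : twisted_sum (c0 R) (CK R cK), ~ ts_trivial E.
Proof.
move=> MA _ hK scK wK.
have lK := weight_large MA cK hK wK.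
have [e [x [f0 [f0c f01 f00 f0x e_cvg]]]] :=
  large_discrete_family MA cK hK scK lK.
pose f b : CK R cK := @SupFun R K (continuous_space R cK) _ (mem_set (f0c b)).
have [n [Kn _]] := scK.
have [c cP] := functionals_codable f codable_cantor Kn.
have [j jI] := codable_sequence codable_cantor.
pose adm (Phi : nat -> CK R cK -> R) := forall n, level_bounded f 0 (Phi n).
(* The threshold lies halfway between the limits that a splitting gives [Phi n (f b)]: 1 along the
   set assigned to [b], and 0 away from it. *)
pose mx (Phi : nat -> CK R cK -> R) b := [set n | 1 / 2 < Phi n (f b)].
(* The code of a sequence of functionals determines its values at f_b; when this
   code is b itself, the b-th set of the family is chosen to differ from the one
   that the sequence would produce. *)
pose avoids b beta := forall Phi, adm Phi -> j (fun n => c (Phi n)) = b ->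
  ~ exists N, forall n,
    (N <= n)%N -> mx Phi b n <-> branch (cantor_cons beta b) n.
have /choice[beta betaP] : forall b, exists beta, avoids b beta.
  move=> b.
  have [[Psi [aPsi jPsi]]|H] :=
      pselect (exists Phi, adm Phi /\ j (fun n => c (Phi n)) = b); last first.
    by exists true => Phi aPhi jPhi; case: H; exists Phi.
  have [beta bP] := branch_avoid b (mx Psi b); exists beta => Phi aPhi jPhi.
  suff -> : mx Phi b = mx Psi b by [].
  apply/seteqP; suff H' k : Phi k (f b) = Psi k (f b).
    by split=> k; rewrite /mx /= H'.
  apply: cP => //; move: jPhi; rewrite -jPsi => /jI.
  exact: (congr1 (@^~ k)).
pose A b := branch (cantor_cons (beta b) b).
have A_ad b b' : b <> b' -> exists N, forall n, (N <= n)%N -> A b n -> ~ A b' n.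
  by move=> bb'; apply: branch_ad => /cantor_cons_inj[_ /bb'].
exists (ad_twisted_sum cK A_ad e_cvg) => /ad_trivial[Phi [lPhi [d dPhi] cPhi]].
have aPhi : adm Phi.
  move=> k; split; first exact: lPhi.
  exists `|d| => g _ M M0 gM; apply: (le_trans (dPhi k g)).
  apply: (le_trans (ler_wpM2r (normr_ge0 g) (ler_norm d))).
  by rewrite ler_wpM2l// supnorm_le// => y; exact: gM.
pose b := j (fun n => c (Phi n)).
apply: (betaP b Phi aPhi erefl).
have half : 0 < 1 / 2 :> R by rewrite divr_gt0.
have [_ [N NP]] : ad_filter A (Some b) (mx Phi b).
  have /cvgrPdist_lt/(_ _ half) := cPhi (f b) (Some b).
  apply: filterS => k /=; rewrite f01 ltr_norml /mx/= => /andP[_].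
  by lra.
(* The other limits are [f b x = 0] and [f b (e b') = 0], so past some index the threshold is
   exceeded only inside [A b]. *)
have [M _ MP] : \oo [set k | mx Phi b k -> A b k].
  apply: (@ad_filter_near _ A) => o.
  have /cvgrPdist_lt/(_ _ half) := cPhi (f b) o.
  case: o => [b'|] /=; last first.
    rewrite f0x; apply: filterS => k /=; rewrite sub0r normrN /mx/= => kP.
    by have := ler_norm (Phi k (f b)); lra.
  have [<-|/eqP bb'] := eqVneq b b'.
    by move=> _; exists [::], 0%N => k _ Abk _.
  rewrite f00//; apply: filterS => k /=; rewrite sub0r normrN /mx/= => kP.
  by have := ler_norm (Phi k (f b)); lra.
exists (maxn N M) => k; rewrite geq_max => /andP[Nk Mk].
by split; [exact: MP|exact: NP].
Qed.
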